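(* For $d \geq 1$ let $\gamma(d)$ be the infimum, over all $n\ge 1$ and all $(2,3)$-agreeable arrangements of $n$ $d$-boxes, of (maximal number of boxes sharing a common point)$/n$. Then $\gamma(d)>0$; more precisely $\gamma(d) \geq F^{[d-1]}(1/2)$, where $F^{[d-1]}$ is the $(d-1)$-fold iterate of $$F(x)=\frac{-2 - x + \sqrt{4 - 4x + 5x^2}}{2(x-2)}.$$ In particular $\gamma(2) \geq \frac{5-\sqrt{13}}{6}\approx 0.2324$.
   Context: A $d$-box is a Cartesian product of $d$ closed intervals in $\mathbb{R}^d$. An arrangement of boxes is $(2,3)$-agreeable if among any three of its boxes at least two have non-empty intersection. *)

(* Defs.v *)
From HB Require Import structures.
From mathcomp Require Import all_boot all_order all_algebra.
From mathcomp Require Import all_classical all_reals.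

Set Implicit Arguments.
Unset Strict Implicit.
Unset Printing Implicit Defensive.

Import Order.TTheory GRing.Theory Num.Theory.

Local Open Scope classical_set_scope.
Local Open Scope ring_scope.

(* The intervals are nonempty (possibly reduced to a point): with an empty box
   allowed, the one-box arrangement {set0} would force gamma d = 0. *)
Definition is_box (R : realType) (d : nat) (B : set 'rV[R]_d) : Prop :=
  exists a b : 'rV[R]_d, (forall j, a 0 j <= b 0 j) /\
    B = [set x | forall j, x 0 j \in `[a 0 j, b 0 j]].

(* An arrangement is a family indexed by 'I_n, so a box may be repeated; the
   three boxes below are distinct as members of the family. *)
Definition agreeable23 (R : realType) (d n : nat)
    (B : 'I_n -> set 'rV[R]_d) : Prop :=
  forall i j k : 'I_n, i != j -> i != k -> j != k ->
    [\/ B i `&` B j !=set0, B i `&` B k !=set0 | B j `&` B k !=set0].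

Definition max_depth (R : realType) (d n : nat)
    (B : 'I_n -> set 'rV[R]_d) : nat :=
  \max_(A : {set 'I_n} | `[< exists x, forall i, i \in A -> B i x >]) #|A|.

Definition gamma (R : realType) (d : nat) : R :=
  inf [set r : R | exists (n : nat) (B : 'I_n -> set 'rV[R]_d),
    [/\ (1 <= n)%N, forall i, is_box (B i), agreeable23 B &
        r = (max_depth B)%:R / n%:R]].

Definition F (R : realType) (x : R) : R :=
  (- 2 - x + Num.sqrt (4 - 4 * x + 5 * x ^+ 2)) / (2 * (x - 2)).

(* Main.v *)
Require Import Defs.
From mathcomp Require Import all_boot all_order all_algebra.
From mathcomp Require Import all_classical all_reals.
From mathcomp Require Import ring lra.

Import Order.TTheory GRing.Theory Num.Theory.

Local Open Scope ring_scope.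

(** The bound obtained is in fact [gamma d >= 1/(d+1)].  Let [t] be the least
upper endpoint, in some coordinate, of the boxes of an arrangement of depth [D].
The boxes missing the hyperplane at height [t] all lie above it, so they are
disjoint from the box realising [t]; by agreeability they meet pairwise, hence
have a common point (Helly), and there are at most [D] of them.  The others all
cross the hyperplane, which eliminates one coordinate.  When all [d]
coordinates are eliminated at most [D] boxes remain, so [n <= (d+1) D].
Since [0 <= F x <= x/2] on [[0, 1]], the iterate [F^[d-1](1/2)] is at most
[1/2^d <= 1/(d+1)]. *)

Section Boxes.
Context {R : realType} {d : nat} {I : finType}.
Variables (a b : I -> 'rV[R]_d).

Let in_box (x : 'rV[R]_d) (i : I) : Prop := forall j, a i 0 j <= x 0 j <= b i 0 j.

(** Pairwise meeting puts every lower endpoint below every upper one in each coordinate, so the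
    coordinatewise largest lower endpoints form a common point. *)
Lemma helly_boxes (A : {set I}) :
  (forall i j, i \in A -> j \in A -> exists x, in_box x i /\ in_box x j) ->
  exists x, forall i, i \in A -> in_box x i.
Proof.
move=> meetA; case: (set_0Vmem A) => [->|[i0 Ai0]].
  by exists 0 => i; rewrite inE.
exists (\row_j a [arg max_(i > i0 in A) a i 0 j]%O 0 j) => i Ai j.
rewrite mxE; case: arg_maxP => //= k Ak maxk; apply/andP; split; first exact: maxk.
have [x [xi xk]] := meetA _ _ Ai Ak.
have /andP[_ xib] := xi j; have /andP[kax _] := xk j.
exact: le_trans kax xib.
Qed.

Hypothesis agree : forall i j k : I, i != j -> i != k -> j != k ->
  [\/ exists x, in_box x i /\ in_box x j,
      exists x, in_box x i /\ in_box x k |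
      exists x, in_box x j /\ in_box x k].
Hypothesis nonempty : forall i j, a i 0 j <= b i 0 j.
Variable D : nat.
Hypothesis depth : forall (A : {set I}) x,
  (forall i, i \in A -> in_box x i) -> (#|A| <= D)%N.

Lemma disjoint_from_box_card (i0 : I) (A : {set I}) :
  (forall i x, i \in A -> in_box x i0 -> ~ in_box x i) -> (#|A| <= D)%N.
Proof.
move=> disjA; have box_self i : in_box (a i) i by move=> j; rewrite lexx nonempty.
(* Agreeability applies only to three distinct indices; [i0] is outside [A] because box [i] contains
   its corner [a i]. *)
have neq_i0 i : i \in A -> i0 != i.
  by move=> Ai; apply/eqP => i0i; apply: (disjA i (a i)); rewrite // i0i.
suff /helly_boxes[x] : forall i j, i \in A -> j \in A ->
    exists x, in_box x i /\ in_box x j by exact: depth.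
move=> i j Ai Aj; case: (eqVneq i j) => [<-|ij]; first by exists (a i).
have [[x [x0 xi]]|[x [x0 xj]]|//] := agree i0 i j (neq_i0 i Ai) (neq_i0 j Aj) ij.
  by have := disjA i x Ai x0.
by have := disjA j x Aj x0.
Qed.

(** Invariant of the elimination: coordinates [j >= k] are already fixed by [t], and each remaining
    one costs at most [D] boxes. At [k = 0] the point [t] lies in all boxes of [A]. *)
Lemma card_crossing_family (k : nat) (t : 'rV[R]_d) (A : {set I}) :
  (forall i (j : 'I_d), i \in A -> (k <= j)%N -> a i 0 j <= t 0 j <= b i 0 j) ->
  (#|A| <= k.+1 * D)%N.
Proof.
elim: k t A => [|k IHk] t A crossA.
  by rewrite mul1n; apply: (depth A t) => i Ai j; apply: crossA.
case: (set_0Vmem A) => [->|[i0 Ai0]]; first by rewrite cards0.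
(* If [d <= k], there is no coordinate [k] to eliminate and the induction hypothesis applies
   vacuously. *)
have [ltkd|ledk] := ltnP k d; last first.
  apply: leq_trans (IHk t A _) _; last by rewrite leq_mul2r leqnSn orbT.
  by move=> i j _ lekj; have := leq_trans ledk lekj; rewrite leqNgt ltn_ord.
pose c := Ordinal ltkd.
case: (arg_minP (fun i => b i 0 c) Ai0) => m Am minm.
(* By minimality of [b m 0 c], the lower endpoint alone decides which boxes of [A] cross the
   hyperplane. *)
pose H := [set i | a i 0 c <= b m 0 c].
rewrite -(cardsID H A) mulSn addnC; apply: leq_add.
  apply: (disjoint_from_box_card m) => i x.
  rewrite !inE -ltNge => /andP[lt_mi _] /(_ c)/andP[_ xm] /(_ c)/andP[xi _].
  by have := lt_le_trans lt_mi (le_trans xi xm); rewrite ltxx.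
apply: (IHk (\row_j if j == c then b m 0 c else t 0 j)) => i j.
rewrite !inE mxE => /andP[Ai Hi] lekj.
case: eqVneq => [->|jc]; first by rewrite Hi; exact: minm.
apply: crossA => //; rewrite ltn_neqAle lekj andbT.
by apply: contraNneq jc => kj; apply/eqP/val_inj; rewrite /= kj.
Qed.

Lemma card_boxes : (#|I| <= d.+1 * D)%N.
Proof.
(* At [k = d] no coordinate is constrained, so [0] is an arbitrary choice. *)
rewrite -cardsT; apply: (card_crossing_family d 0) => i j _.
by rewrite leqNgt ltn_ord.
Qed.

End Boxes.

Local Open Scope classical_set_scope.
Local Open Scope ring_scope.

Lemma max_depth_ge {R : realType} {d n : nat} (B : 'I_n -> set 'rV[R]_d) :
  (forall i, is_box (B i)) -> agreeable23 B -> (n <= d.+1 * max_depth B)%N.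
Proof.
move=> boxB agreeB.
have boxE i : exists ab : 'rV[R]_d * 'rV[R]_d, (forall j, ab.1 0 j <= ab.2 0 j) /\
    forall x, B i x <-> forall j, ab.1 0 j <= x 0 j <= ab.2 0 j.
  by have [a [b [ab ->]]] := boxB i; exists (a, b).
have [ab abP] := choice boxE.
have BE i x : B i x <-> forall j, (ab i).1 0 j <= x 0 j <= (ab i).2 0 j.
  exact: (abP i).2.
rewrite -[X in (X <= _)%N]card_ord; apply: (card_boxes (fst \o ab) (snd \o ab)).
- move=> i j k ij ik jk; have := agreeB i j k ij ik jk.
  by case=> -[x [/BE xi /BE xj]]; [apply: Or31|apply: Or32|apply: Or33]; exists x.
- by move=> i j; have [] := abP i.
- move=> A x xA; rewrite /max_depth.
  apply: (leq_bigmax_cond (F := fun A : {set 'I_n} => #|A|)).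
  by apply/asboolP; exists x => i iA; apply/BE/xA.
Qed.

Lemma gamma_ge (R : realType) (d : nat) : d.+1%:R^-1 <= gamma R d.
Proof.
apply: lb_le_inf.
  (* A lower bound passes to [inf] only for a nonempty set; a single one-point box is vacuously
     agreeable. *)
  pose B (_ : 'I_1) := [set x : 'rV[R]_d | forall j, x 0 j \in `[0, 0]].
  exists ((max_depth B)%:R / 1%:R), 1%N, B; split=> //.
    move=> i; exists 0, 0; split=> [j|]; first by rewrite lexx.
    by apply/seteqP; split=> x xB j; have := xB j; rewrite !mxE.
  by move=> i j k; rewrite !ord1.
move=> _ [n [B [n_gt0 boxB agreeB ->]]].
rewrite ler_pdivlMr ?ltr0n // mulrC ler_pdivrMr ?ltr0n // -natrM ler_nat mulnC.
exact: max_depth_ge.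
Qed.

Lemma F_bounds {R : realType} (x : R) : 0 <= x <= 1 -> 0 <= F x <= x / 2.
Proof.
move=> /andP[x0 x1]; rewrite /F; set D := 4 - _ + _.
have D0 : 0 <= D by rewrite /D; nra.
have := sqr_sqrtr D0; have := sqrtr_ge0 D; set s := Num.sqrt D => s0 sD.
(* Since [F x = (2 + x - s) / (2 * (2 - x))], the two claims amount to [s <= 2 + x] and
   [2 - x + x ^+ 2 <= s]. *)
have s_le : s <= 2 + x by rewrite -ler_sqr ?nnegrE ?sD ?/D; nra.
have s_ge : 2 - x + x ^+ 2 <= s.
  rewrite -ler_sqr ?nnegrE ?sD ?/D; [|nra|by []].
  (* This product is exactly [D - (2 - x + x ^+ 2) ^+ 2]. *)
  have : 0 <= x ^+ 3 * (2 - x) by apply: mulr_ge0; [exact: exprn_ge0|lra].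
  by nra.
have -> : (- 2 - x + s) / (2 * (x - 2)) = (2 + x - s) / (2 * (2 - x)).
  by field; apply/andP; split; apply/eqP; lra.
by rewrite divr_ge0 ?ler_pdivrMr; nra.
Qed.

Lemma iter_F_bounds {R : realType} (k : nat) :
  0 <= iter k (@F R) (1 / 2) <= (2 ^+ k.+1)^-1.
Proof.
elim: k => [|k /andP[y0 yk]]; first by rewrite /= expr1 mul1r invr_ge0 ler0n lexx.
have y1 : iter k (@F R) (1 / 2) <= 1.
  by apply: le_trans yk _; rewrite invf_le1 ?exprn_gt0 ?exprn_ege1 // ler1n.
rewrite iterS; have /andP[-> Fy] := F_bounds _ (introT andP (conj y0 y1)).
by apply: le_trans Fy _; rewrite exprSr invfM ler_wpM2r // invr_ge0.
Qed.

Theorem theoremA1 (R : realType) :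
  (forall d : nat, (1 <= d)%N ->
     0 < gamma R d /\ iter d.-1 (@F R) (1 / 2) <= gamma R d) /\
  (5 - Num.sqrt 13) / 6 <= gamma R 2 /\
  `|(5 - Num.sqrt 13) / 6 - 2324 / 10000 : R| < 1 / 20000.
Proof.
have [s0 s13] : 0 <= Num.sqrt (13 : R) /\ Num.sqrt (13 : R) ^+ 2 = 13.
  by rewrite sqrtr_ge0 sqr_sqrtr // ler0n.
split; last split.
- move=> [//|d] _; have gd := gamma_ge R d.+1.
  split; first by apply: lt_le_trans gd; rewrite invr_gt0 ltr0n.
  have /andP[_ Fd] := @iter_F_bounds R d.
  apply: le_trans Fd (le_trans _ gd).
  by rewrite lef_pV2 ?posrE ?exprn_gt0 ?ltr0n // -natrX ler_nat ltn_expl.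
(* The general bound gives 1/3 here, and [Num.sqrt 13 >= 3] suffices. *)
- by apply: le_trans (gamma_ge R 2); nra.
- by rewrite ltr_norml; apply/andP; split; nra.
Qed.
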